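(* Let $\psi\in C^1(\mathbb{R})$ satisfy: $\psi(0)=1$, $\psi$ is even, there exist $C>0$ and $\delta>1$ with $|\psi(x)|+|x\psi'(x)|\leq C\langle x\rangle^{-\delta}$ for all $x\in\mathbb{R}$, and $A_\psi:=\int_{\mathbb{R}}\psi(x)\,\mathrm{d}x\neq 0$. Let $\mu$ be a probability measure on $\mathbb{R}$. Then: 1. For every continuous function $f$ of compact support, $\lim_{a\to 0}\int(\tilde{\psi}_a*\mu)(x)f(x)\,\mathrm{d}x=A_\psi\int f(x)\,\mathrm{d}\mu(x)$. 2. For every $x\in\mathbb{R}$, $\lim_{a\to 0}(\psi_a*\mu)(x)=\mu(\{x\})$. 3. If $0<\alpha\leq 1$ and $(d_\alpha\mu)(x)$ exists and is finite, then $\lim_{a\to 0}a^{-\alpha}(\psi_a*\mu)(x)=c_\alpha(d_\alpha\mu)(x)$, where $c_\alpha=\int_0^\infty \alpha 2^\alpha y^{\alpha-1}\psi(y)\,\mathrm{d}y$.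
   Context: $\langle x\rangle=(1+x^2)^{1/2}$. For $a>0$, $\psi_a(x)=\psi(x/a)$ and $\tilde{\psi}_a(x)=\frac{1}{a}\psi_a(x)$. The convolution is $(f*\mu)(x)=\int f(x-y)\,\mathrm{d}\mu(y)$. For $0\leq\alpha\leq1$, $(d_\alpha\mu)(x)=\lim_{\varepsilon\downarrow0}\mu((x-\varepsilon,x+\varepsilon))/(2\varepsilon)^\alpha$ whenever this limit exists. Limits $a\to0$ are over $a>0$. *)

(* Defs.v *)
From HB Require Import structures.
From mathcomp Require Import all_boot all_order all_algebra.
From mathcomp Require Import all_classical all_reals all_analysis.
Set Implicit Arguments. Unset Strict Implicit. Unset Printing Implicit Defensive.
Import Order.TTheory GRing.Theory Num.Theory.
Import numFieldNormedType.Exports.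
Local Open Scope classical_set_scope.
Local Open Scope ring_scope.

Definition jbr {R : realType} (x : R) : R := Num.sqrt (1 + x ^+ 2).

Definition dil {R : realType} (psi : R -> R) (a : R) : R -> R :=
  fun x => psi (x / a).

Definition ndil {R : realType} (psi : R -> R) (a : R) : R -> R :=
  fun x => a^-1 * dil psi a x.

Definition convol {R : realType} (f : R -> R)
  (mu : {measure set (measurableTypeR R) -> \bar R}) (x : R) : R :=
  Rintegral mu setT (fun y : measurableTypeR R => f (x - y)).

Definition dratio {R : realType} (mu : {measure set (measurableTypeR R) -> \bar R})
  (alpha x e : R) : R :=
  fine (mu [set` `]x - e, x + e[%classic]) / (2 * e) `^ alpha.

Definition dalpha_is {R : realType} (mu : {measure set (measurableTypeR R) -> \bar R})
  (alpha x L : R) : Prop :=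
  dratio mu alpha x e @[e --> 0^'+] --> L.

(* Main.v *)
Require Import Defs.
From HB Require Import structures.
From mathcomp Require Import all_boot all_order all_algebra.
From mathcomp Require Import all_classical all_reals all_analysis.
From mathcomp Require Import measurable_realfun ring lra.
Import Order.TTheory GRing.Theory Num.Theory.
Import numFieldNormedType.Exports.
Local Open Scope classical_set_scope.
Local Open Scope ring_scope.

(** All integrands are dominated by multiples of [(1 + |x|)^(- delta)].  Parts 1
    and 2 are dominated convergence, for part 1 on the product of [mu] and
    Lebesgue measure after Fubini and the substitution [x = y + a u].  For part 3,
    evenness and [psi u = - int_u^oo psi'] give the layer-cake formula
    [(psi_a * mu)(x) = - int_0^oo psi'(s) mu(]x - a s, x + a s[) ds]; after division
    by [a^alpha] the integrand is [- psi'(s) (2 s)^alpha] times the ratio defining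
    [d_alpha mu], evaluated at [a s].  The same layer-cake formula applied to the
    measure [alpha 2^alpha t^(alpha - 1) dt] identifies the limit constant. *)

(** * Dominated convergence for a parameter decreasing to 0 *)

(** A right limit can be tested along positive sequences tending to 0, which reduces the claim to
    dominated convergence for sequences. Integrability of [f] makes the limit finite, so the
    convergence passes to real values. *)
Lemma Rintegral_dominated_at_right d (T : measurableType d) (R : realType)
    (m : {measure set T -> \bar R}) (D : set T) (F : R -> T -> R) (f h : T -> R) :
  measurable D ->
  (forall a, 0 < a -> measurable_fun D (F a)) ->
  measurable_fun D f ->
  m.-integrable D (EFin \o h) ->
  (forall a x, 0 < a -> D x -> `|F a x| <= h x) ->
  (forall x, D x -> F a x @[a --> 0^'+] --> f x) ->
  Rintegral m D (F a) @[a --> 0^'+] --> Rintegral m D f.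
Proof.
move=> mD mF mf hint Fh Ff; apply/cvg_at_rightP => u u0cvg.
have [u0 _] := u0cvg.
have [|||||fint _ fcvg] := @dominated_convergence _ _ _ m D mD
  (fun n => EFin \o F (u n)) (EFin \o f) (EFin \o h).
- by move=> n; apply/measurable_EFinP/mF/u0.
- exact/measurable_EFinP.
- apply: aeW => x Dx /=; apply: cvg_EFin; first exact: nearW.
  by have /cvg_at_rightP := Ff x Dx; exact.
- by [].
- by apply: aeW => x n Dx /=; rewrite lee_fin Fh.
apply: fine_cvg; rewrite fineK //.
exact: integrable_fin_num.
Qed.

(** * The majorant [(1 + |x|) ^ (- delta)] and improper integrals *)

Lemma is_derive_powR_add1 (R : realType) (b s : R) : 0 <= s ->
  is_derive s 1 (fun t : R => (1 + t) `^ b) (b * (1 + s) `^ (b - 1)).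
Proof.
move=> s0; have s1 : 0 < 1 + s by lra.
have dp := is_derive1_powR b s1.
have := @is_derive1_comp R (fun t => t `^ b) (fun t => 1 + t) s _ 1 dp.
rewrite mulr1; apply.
have := @is_deriveD R R R (cst 1) id s 1 0 1 _ _.
by rewrite add0r; apply.
Qed.

Lemma cvgy_powR_add1 (R : realType) (b : R) : 0 < b ->
  (1 + t) `^ (- b) @[t --> +oo] --> (0 : R).
Proof.
move=> b0; apply/cvgr0Pnorm_lt => e e0.
near=> t.
(* The threshold solves [(1 + t) ^ (- b) = e] for [1 + t]. *)
have ht : e^-1 `^ b^-1 < 1 + t.
  rewrite -ltrBlDl; near: t; apply: nbhs_pinfty_gt; exact: num_real.
have p0 : 0 < e^-1 `^ b^-1 by apply: powR_gt0; rewrite invr_gt0.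
have t0 : 0 < 1 + t by apply: lt_trans ht.
rewrite powRN ger0_norm ?invr_ge0 ?powR_ge0// invf_plt ?posrE ?powR_gt0//.
have := @gt0_ltr_powR _ b b0 _ _ _ _ ht.
rewrite !nnegrE (ltW p0) (ltW t0) => /(_ isT isT).
by rewrite -powRrM mulVf ?gt_eqF// powRr1// invr_ge0 ltW.
Unshelve. all: by end_near. Qed.

(** The primitive [F] has exponent [1 - delta < 0], so it vanishes at infinity and only its value at
    [u] remains. *)
Lemma integral_powR_add1 (R : realType) (delta u : R) : 1 < delta -> 0 <= u ->
  (\int[@lebesgue_measure R]_(t in `[u, +oo[) ((1 + t) `^ (- delta))%:E =
   ((1 + u) `^ (1 - delta) / (delta - 1))%:E)%E.
Proof.
move=> d1 u0; have dn0 : 1 - delta != 0 by lra.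
pose F (t : R) : R := (1 - delta)^-1 * (1 + t) `^ (1 - delta).
have dF (t : R) : 0 <= t -> is_derive t 1 F ((1 + t) `^ (- delta)).
  move=> t0; have dp := is_derive_powR_add1 R (1 - delta) t t0.
  have := is_deriveZ (1 - delta)^-1 dp.
  rewrite /GRing.scale/= mulrA mulVf// mul1r addrAC subrr add0r; exact.
transitivity (0%:E - (F u)%:E)%E; last first.
  rewrite sub0e -EFinN; congr EFin; rewrite /F mulrC -mulrN -invrN.
  by congr (_ * _^-1); ring.
apply: ge0_continuous_FTC2y.
- by move=> x _; rewrite powR_ge0.
- apply: derivable_within_continuous => x; rewrite in_itv/= andbT => ux.
  have dp := is_derive_powR_add1 R (- delta) x (le_trans u0 ux).
  exact: ex_derive.
- rewrite -[X in _ --> X](mulr0 (1 - delta)^-1); apply: cvgM; first exact: cvg_cst.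
  have := cvgy_powR_add1 R (delta - 1).
  by rewrite opprB subr_gt0; apply.
- by move=> x ux; have dp := dF x (ltW (le_lt_trans u0 ux)); exact: ex_derive.
- apply: cvg_at_right_filter; have dp := dF u u0.
  have /derivable1_diffP/differentiable_continuous : derivable F u 1.
    exact: ex_derive.
  exact.
- move=> x; rewrite in_itv/= andbT => ux.
  by rewrite derive1E; have dp := dF x (ltW (le_lt_trans u0 ux)); exact: derive_val.
Qed.

Lemma continuous_powR_add1_norm (R : realType) (b : R) :
  continuous (fun x : R => (1 + `|x|) `^ b).
Proof.
move=> x.
have : {for `|x|, continuous (fun t : R => (1 + t) `^ b)}.
  have dp := is_derive_powR_add1 R b _ (normr_ge0 x).
  apply: differentiable_continuous; apply/derivable1_diffP; exact: ex_derive.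
exact: (@cvg_comp _ _ _ (fun y : R => `|y|) (fun t : R => (1 + t) `^ b) _ _ _
  (@norm_continuous R R x)).
Qed.

(** By evenness the integral is twice the one over the half-line, which is explicit. *)
Lemma integrable_powR_add1_norm (R : realType) (delta : R) : 1 < delta ->
  (@lebesgue_measure R).-integrable setT
    (EFin \o (fun x : R => (1 + `|x|) `^ (- delta))).
Proof.
move=> d1; apply/integrableP; split.
  apply/measurable_EFinP; apply: continuous_measurable_fun.
  exact: continuous_powR_add1_norm.
under eq_integral do rewrite /= ger0_norm ?powR_ge0//.
rewrite ge0_symfun_integralT; first last.
- by move=> x /=; rewrite normrN.
- exact: continuous_powR_add1_norm.
- by move=> x; rewrite powR_ge0.
rewrite -set_itvcy.
under eq_integral => x.
  rewrite inE/= in_itv/= andbT => x0; rewrite ger0_norm//.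
  over.
by rewrite integral_powR_add1// -EFinM ltry.
Qed.

Lemma powR_add1_norm_le1 (R : realType) (delta x : R) : 0 <= delta ->
  (1 + `|x|) `^ (- delta) <= 1.
Proof.
move=> d0; rewrite -[leRHS](powRr0 (1 + `|x|)).
by apply: ler_powR; rewrite ?lerDl// oppr_le0.
Qed.

(** Squaring shows that [(1 + |x|) / 2 <= jbr x]; a negative power reverses the inequality. This
    trades the bracket for a majorant with an elementary primitive. *)
Lemma jbr_powR_le (R : realType) (delta x : R) : 0 <= delta ->
  jbr x `^ (- delta) <= 2 `^ delta * (1 + `|x|) `^ (- delta).
Proof.
move=> d0.
have x1 : 0 < 1 + `|x| by rewrite ltr_pwDl.
have hj : (1 + `|x|) / 2 <= jbr x.
  rewrite /jbr -[leLHS]ger0_norm ?divr_ge0 ?(ltW x1)// -sqrtr_sqr ler_wsqrtr//.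
  by rewrite -[x ^+ 2]real_normK ?num_real//; nra.
have j0 : 0 < jbr x by apply: lt_le_trans hj; rewrite divr_gt0.
rewrite !powRN -ler_pdivrMr ?invr_gt0 ?powR_gt0// invrK.
rewrite ler_pdivrMl ?powR_gt0// -ler_pdivrMr ?powR_gt0//.
have -> : (1 + `|x|) `^ delta / 2 `^ delta = ((1 + `|x|) / 2) `^ delta.
  rewrite powRM ?(ltW x1) ?invr_ge0//; congr (_ * _).
  by rewrite -[in RHS]powR_inv1// -powRrM mulN1r powRN.
by apply: ge0_ler_powR => //; rewrite nnegrE ?divr_ge0 ?(ltW x1) ?(ltW j0).
Qed.

(* The integrand has no sign, so [h] is added to make the improper fundamental
   theorem of calculus applicable. *)
Lemma Rintegral_FTC2y_dominated (R : realType) (F f H h : R -> R) (u : R) :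
  continuous f -> continuous h ->
  (forall x, u <= x -> is_derive x 1 F (f x)) ->
  (forall x, u <= x -> is_derive x 1 H (h x)) ->
  (forall x, u <= x -> `|f x| <= h x) ->
  F x @[x --> +oo] --> 0 -> H x @[x --> +oo] --> 0 ->
  Rintegral (@lebesgue_measure R) `[u, +oo[ f = - F u.
Proof.
move=> cf ch dF dH fh Fy Hy.
have key (G g : R -> R) : continuous g -> (forall x, u <= x -> 0 <= g x) ->
    (forall x, u <= x -> is_derive x 1 G (g x)) -> G x @[x --> +oo] --> 0 ->
    (\int[@lebesgue_measure R]_(x in `[u, +oo[) (g x)%:E = (- G u)%:E)%E.
  move=> cg g0 dG Gy; transitivity (0%:E - (G u)%:E)%E; last by rewrite sub0e.
  apply: ge0_continuous_FTC2y => //.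
  - exact: continuous_subspaceT.
  - by move=> x ux; have dp := dG x (ltW ux); exact: ex_derive.
  - apply: cvg_at_right_filter; have dp := dG u (lexx u).
    have /derivable1_diffP/differentiable_continuous : derivable G u 1.
      exact: ex_derive.
    exact.
  - move=> x; rewrite in_itv/= andbT => ux.
    by rewrite derive1E; have dp := dG x (ltW ux); exact: derive_val.
have h0 x : u <= x -> 0 <= h x by move=> ux; exact: le_trans (fh x ux).
have mE (g : R -> R) : continuous g -> measurable_fun `[u, +oo[ (EFin \o g).
  move=> cg; apply/measurable_EFinP; apply: measurable_funTS.
  exact: continuous_measurable_fun.
have hE := key _ _ ch h0 dH Hy.
have hint : (@lebesgue_measure R).-integrable `[u, +oo[ (EFin \o h).
  apply/integrableP; split; first exact: mE.
  under eq_integral => x.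
    rewrite inE/= in_itv/= andbT => ux; rewrite ger0_norm ?h0//.
    over.
  by rewrite hE ltry.
have fint : (@lebesgue_measure R).-integrable `[u, +oo[ (EFin \o f).
  apply: le_integrable hint => //; first exact: mE.
  move=> x /=; rewrite in_itv/= andbT => ux.
  by rewrite lee_fin (le_trans (fh x ux))// ler_norm.
have fhE : (\int[@lebesgue_measure R]_(x in `[u, +oo[) (f x + h x)%:E =
    (- (F u + H u))%:E)%E.
  apply: (key (fun x => F x + H x)).
  - by move=> x; apply: cvgD; [exact: cf|exact: ch].
  - by move=> x ux; have := fh x ux; rewrite ler_norml => /andP[]; lra.
  - by move=> x ux; apply: is_deriveD; [exact: dF|exact: dH].
  - by rewrite -[X in _ --> X]addr0; exact: cvgD.
have mI : measurable (`[u, +oo[%classic : set (measurableTypeR R)) by [].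
have := RintegralD mI fint hint.
rewrite /Rintegral fhE hE /=; lra.
Qed.

(** * The layer-cake formula, with the bounds and the power weight for its use *)

(** Write [psi (g t)] as the integral of [k] over [s > g t] and exchange the integrals by Fubini:
    for fixed [s], integrating [w] over [g t < s] gives [N s]. The weight [w] lets one formula serve
    both a probability measure with [w = 1] and Lebesgue measure with a power density. *)
Lemma Rintegral_layer_cake (R : realType)
    (m : {sigma_finite_measure set (measurableTypeR R) -> \bar R})
    (g w N k psi : R -> R) :
  measurable_fun setT g -> measurable_fun setT w -> measurable_fun setT k ->
  (forall t, 0 <= g t) -> (forall t, 0 <= w t) ->
  (forall s, 0 < s -> (\int[m]_(t in [set t | (g t < s)%R]) (w t)%:E = (N s)%:E)%E) ->
  (@lebesgue_measure R).-integrable `[0, +oo[ (EFin \o k) ->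
  (@lebesgue_measure R).-integrable `]0, +oo[ (EFin \o (fun s => k s * N s)) ->
  (forall u, 0 <= u -> Rintegral (@lebesgue_measure R) `[u, +oo[ k = psi u) ->
  Rintegral m setT (fun t => psi (g t) * w t) =
  Rintegral (@lebesgue_measure R) `]0, +oo[ (fun s => k s * N s).
Proof.
move=> mg mw mk g0 w0 NE kint kNint psiE.
have mA s : measurable ([set t | g t < s] : set (measurableTypeR R)).
  rewrite (_ : mkset _ = g @^-1` `]-oo, s[); last first.
    by apply/seteqP; split => x; rewrite /= in_itv.
  by rewrite -[X in measurable X]setTI; exact: mg.
have N0 s : 0 < s -> 0 <= N s.
  by move=> s0; rewrite -lee_fin -NE//; apply: integral_ge0 => t _; rewrite lee_fin.
(* The factor [c] is [|k|] when integrability is checked and [k] when the integral is computed. For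
   [s <= 0] the sublevel set is empty since [g >= 0], whence the restriction to [s > 0]. *)
have inner_t (c : R -> R) s :
    (\int[m]_t (if (g t < s)%R then w t * c s else 0)%:E =
     ((fun s => (c s * N s)%:E) \_ `]0%R, +oo[) s)%E.
  transitivity (\int[m]_(t in [set t | (g t < s)%R]) ((c s)%:E * (w t)%:E))%E.
    rewrite [RHS]integral_mkcond; apply: eq_integral => t _.
    rewrite /patch; case: ifPn => [gs|/negP gs]; last by rewrite memNset.
    by rewrite mem_set// -EFinM mulrC.
  rewrite /patch; case: ifPn; last first.
    rewrite notin_setE/= in_itv/= andbT => /negP; rewrite -leNgt => s0.
    rewrite (_ : mkset _ = set0) ?integral_set0//.
    by apply/seteqP; split => x //=; have := g0 x; lra.
  rewrite inE/= in_itv/= andbT => s0.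
  rewrite integralZl// ?NE//; apply/integrableP; split.
    by apply/measurable_EFinP; exact: measurable_funTS.
  by under eq_integral do rewrite /= ger0_norm//; rewrite NE// ltry.
pose F (z : measurableTypeR R * measurableTypeR R) : \bar R :=
  (if g z.1 < z.2 then w z.1 * k z.2 else 0)%:E.
have mF : measurable_fun setT F.
  apply/measurable_EFinP; apply: measurable_fun_ifT => //.
  - apply: measurable_fun_ltr; last exact: measurable_snd.
    exact: measurableT_comp.
  - by apply: measurable_funM; exact: measurableT_comp.
(* With [t] integrated first, the absolute integral becomes that of [|k s| * N s], finite by
   hypothesis. *)
have Fint : (m \x @lebesgue_measure R)%E.-integrable setT F.
  apply/integrable21ltyP => //.
  under eq_integral => s _.
    under eq_integral => t _.
      rewrite /F/= (_ : `|_| = if g t < s then w t * `|k s| else 0); last first.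
        by case: ifP => _; rewrite ?normr0// normrM (ger0_norm (w0 t)).
      over.
    rewrite (inner_t (fun s => `|k s|)).
    over.
  rewrite -integral_mkcond.
  move/integrableP : kNint => [_]; apply: le_lt_trans.
  rewrite le_eqVlt; apply/orP; left; apply/eqP/eq_integral => s.
  rewrite inE/= in_itv/= andbT => s0.
  by rewrite normrM (ger0_norm (N0 s s0)).
rewrite /Rintegral; congr fine.
transitivity (\int[m]_t \int[@lebesgue_measure R]_s F (t, s))%E; last first.
  rewrite (Fubini Fint) [RHS]integral_mkcond; apply: eq_integral => s _.
  exact: inner_t.
apply: eq_integral => t _; rewrite /F/=.
have kint' : (@lebesgue_measure R).-integrable `[g t, +oo[ (EFin \o k).
  apply: integrableS kint => //; apply: subset_itvr; rewrite bnd_simp; exact: g0.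
symmetry; transitivity
    (\int[@lebesgue_measure R]_(s in `]g t, +oo[) ((w t)%:E * (k s)%:E))%E.
  rewrite [RHS]integral_mkcond; apply: eq_integral => s _.
  rewrite /patch; case: ifPn => [gs|/negP gs].
    by rewrite mem_set//= in_itv/= gs.
  by rewrite memNset//= in_itv/= andbT.
(* The endpoint [s = g t] is Lebesgue-null. *)
rewrite integral_itv_obnd_cbnd; last first.
  apply/measurable_EFinP; apply: measurable_funTS.
  by apply: measurable_funM.
rewrite integralZl//.
rewrite -(psiE _ (g0 t)) /Rintegral mulrC EFinM fineK//.
exact: integrable_fin_num.
Qed.

(** On [[0, 1]], [|k|] has a maximum by continuity, [s ^ beta <= 1], and [(1 + s) ^ (- delta)] is at
    least [2 ^ (- delta)]. Beyond 1, [s ^ beta <= s] and the decay of [s * k s] applies. Adding the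
    two constants gives a [K] uniform in [beta]. *)
Lemma powR_mul_norm_le (R : realType) (k : R -> R) (C delta : R) :
  continuous k -> 0 < C -> 0 < delta ->
  (forall x, `|x * k x| <= C * jbr x `^ (- delta)) ->
  exists2 K : R, 0 <= K & forall beta s, 0 <= beta -> beta <= 1 -> 0 <= s ->
    s `^ beta * `|k s| <= K * (1 + s) `^ (- delta).
Proof.
move=> ck C0 d0 kC.
have [c _ cmax] := @EVT_max R (fun x => `|k x|) 0 1 ler01 ltac:(
  apply: continuous_subspaceT => x; exact: (cvg_norm (ck x))).
exists (`|k c| * 2 `^ delta + C * 2 `^ delta).
  by rewrite addr_ge0// mulr_ge0// ?powR_ge0// ltW.
move=> b s b0 b1 s0; rewrite mulrDl.
have p0 : 0 <= (1 + s) `^ (- delta) by exact: powR_ge0.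
have p20 : 0 <= 2 `^ delta :> R by exact: powR_ge0.
have [s1|s1] := leP s 1.
  apply: (@le_trans _ _ (`|k c| * 2 `^ delta * (1 + s) `^ (- delta))); last first.
    by rewrite lerDl !mulr_ge0// ltW.
  rewrite -mulrA -[leLHS]mulrC ler_pM// ?powR_ge0//.
    by apply: cmax; rewrite in_itv/= s0.
  apply: (@le_trans _ _ 1).
    by have := @ge0_ler_powR R b b0 s 1; rewrite powR1 !nnegrE => -> //.
  rewrite powRN ler_pdivlMr ?powR_gt0//; last by lra.
  rewrite mul1r; apply: ge0_ler_powR; rewrite ?nnegrE; lra.
apply: (@le_trans _ _ (C * 2 `^ delta * (1 + s) `^ (- delta))); last first.
  by rewrite lerDr !mulr_ge0.
apply: (@le_trans _ _ `|s * k s|).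
  by rewrite normrM ler_wpM2r// ger0_norm// ler1_powR// ltW.
apply: (le_trans (kC s)); rewrite -mulrA ler_wpM2l ?(ltW C0)//.
by have := jbr_powR_le _ delta s (ltW d0); rewrite (ger0_norm s0).
Qed.

(** The integrand blows up at 0 when [alpha < 1], so the fundamental theorem is applied on compact
    intervals away from 0 that increase to []0, s]]. *)
Lemma integral_powR_subr1 (R : realType) (alpha s : R) : 0 < alpha -> 0 < s ->
  (\int[@lebesgue_measure R]_(t in `]0%R, s[) (alpha * t `^ (alpha - 1))%:E =
   (s `^ alpha)%:E)%E.
Proof.
move=> a0 s0.
have mw : measurable_fun setT (fun t : R => alpha * t `^ (alpha - 1)).
  by apply: measurable_funM => //; exact: measurable_powR.
rewrite integral_itv_bndo_bndc; last first.
  by apply/measurable_EFinP; exact: measurable_funTS.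
(* The divisor [n + 2] keeps the interval nondegenerate already at [n = 0]. *)
pose I n := [set` `[s / n.+2%:R, s]] : set (measurableTypeR R).
have bigI : \bigcup_n I n = `]0, s]%classic.
  apply/seteqP; split => [t [n _]|t]; rewrite /= /I/= !in_itv/=.
    by case/andP => nt ->; rewrite andbT (lt_le_trans _ nt)// divr_gt0.
  move=> /andP[t0 ts]; exists (Num.truncn (s / t)) => //; rewrite /= in_itv/= ts andbT.
  rewrite ler_pdivrMr// mulrC -ler_pdivrMr//.
  by rewrite (le_trans (ltW (truncnS_gt _)))// ler_nat.
have IE n : (\int[@lebesgue_measure R]_(t in I n) (alpha * t `^ (alpha - 1))%:E =
    (s `^ alpha - (s / n.+2%:R) `^ alpha)%:E)%E.
  have sn0 : 0 < s / n.+2%:R by rewrite divr_gt0.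
  have d (b t : R) : s / n.+2%:R <= t -> derivable (fun t : R => t `^ b) t 1.
    move=> st; have dp := is_derive1_powR b (lt_le_trans sn0 st).
    exact: ex_derive.
  have cd (b t : R) : s / n.+2%:R <= t -> {for t, continuous (fun t : R => t `^ b)}.
    by move=> st; apply/differentiable_continuous/derivable1_diffP/d.
  rewrite EFinB; apply: (@continuous_FTC2 R _ (fun t : R => t `^ alpha)).
  - by rewrite ltr_pdivrMr// ltr_pMr// ltr1n.
  - apply: derivable_within_continuous => t; rewrite in_itv/= => /andP[nt _].
    by apply: derivableM => //; exact: d.
  - split.
    + by move=> t; rewrite in_itv/= => /andP[nt _]; apply: d; exact: ltW.
    + by apply: cvg_at_right_filter; apply: cd.
    + apply: cvg_at_left_filter; apply: cd.
      by rewrite ler_pdivrMr// ler_peMr ?ler1n// ltW.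
  - move=> t; rewrite in_itv/= => /andP[nt _].
    by rewrite powR_derive1// in_itv/= andbT (lt_trans sn0).
have c1 : (\int[@lebesgue_measure R]_(t in I n) (alpha * t `^ (alpha - 1))%:E)%E
    @[n --> \oo] --> (s `^ alpha)%:E.
  under eq_fun do rewrite IE.
  apply: cvg_EFin; first exact: nearW.
  rewrite -[X in _ --> X]subr0; apply: cvgB; first exact: cvg_cst.
  have /cvg_at_rightP := powR_cvg0 a0; apply; split; first by move=> n; rewrite divr_gt0.
  rewrite -[X in _ --> X](mulr0 s); apply: cvgM; first exact: cvg_cst.
  exact: (@cvg_comp _ _ _ S (fun n => n.+1%:R^-1 : R) _ _ _ (@cvg_addnl 1)
    (@cvg_harmonic R)).
rewrite -bigI; apply: cvg_unique c1; first exact: ereal_hausdorff.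
apply: (@ge0_nondecreasing_set_cvg_integral _ _ _ I _ (@lebesgue_measure R)).
- apply/nondecreasing_seqP => n; rewrite subsetEset /I.
  apply: subset_itvr; rewrite bnd_simp ler_wpM2l ?(ltW s0)//.
  by rewrite lef_pV2 ?posrE// ler_nat.
- by move=> n; exact: measurable_itv.
- by move=> n; apply/measurable_EFinP; exact: measurable_funTS.
- by move=> n x _; rewrite lee_fin mulr_ge0 ?powR_ge0 ?ltW.
Qed.

(** * Affine substitution for Lebesgue measure *)

(** The pushforward of Lebesgue measure under [u |-> y + a * u], scaled by [a], has the right value
    on half-open intervals, so it is Lebesgue measure by uniqueness. This settles nonnegative
    functions; positive and negative parts give the rest. *)
Lemma integral_affine (R : realType) (a y : R) (F : R -> \bar R) :
  0 < a -> measurable_fun setT F ->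
  (\int[@lebesgue_measure R]_x F x =
   \int[@lebesgue_measure R]_u (a%:E * F (y + a * u)%R))%E.
Proof.
move=> a0 mF; pose phi (u : measurableTypeR R) : measurableTypeR R := y + a * u.
have mphi : measurable_fun setT phi.
  by apply: measurable_funD => //; exact: measurable_funM.
have key (G : R -> \bar R) : measurable_fun setT G -> (forall x, (0 <= G x)%E) ->
    (\int[@lebesgue_measure R]_x G x =
     \int[@lebesgue_measure R]_u (a%:E * G (phi u)))%E.
  move=> mG G0; pose r := NngNum (ltW a0).
  rewrite ge0_integralZl//; last 2 first.
    exact: measurableT_comp.
    by rewrite lee_fin ltW.
  rewrite -[in RHS](preimage_setT phi) -(ge0_integral_pushforward mphi)//.
  rewrite -[a%:E]/(r%:num%:E) -ge0_integral_mscale//.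
  apply: eq_measure_integral => A mA _; apply: lebesgue_measure_unique => //.
  move=> _ [[c d] _ <-] /=.
  rewrite lebesgue_measure_itv/= /mscale/= /pushforward.
  rewrite (_ : phi @^-1` _ = `](c - y) / a, (d - y) / a]%classic); last first.
    apply/seteqP; split => u; rewrite /= !in_itv/= /phi ltr_pdivrMr// ler_pdivlMr//;
      by rewrite ltrBlDl lerBrDl mulrC.
  rewrite lebesgue_measure_itv/= !lte_fin ltr_pM2r ?invr_gt0// ltrD2r.
  case: ifP => _; rewrite ?mule0// -!EFinB -EFinM; congr EFin.
  by field; rewrite gt_eqF.
rewrite [LHS]integralE [RHS]integralE.
rewrite (ge0_funeposM (F \o phi) (ltW a0)) (ge0_funenegM (F \o phi) (ltW a0)).
congr (_ - _)%E.
- rewrite (key (F^\+)%E)//; last exact: measurable_funepos.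
  by apply: eq_integral => u _; rewrite !funeposE.
- rewrite (key (F^\-)%E)//; last exact: measurable_funeneg.
  by apply: eq_integral => u _; rewrite !funenegE.
Qed.

(** * Recovery of the atoms of [mu] *)

(** As [a] tends to 0, [psi ((x - y) / a)] tends to the indicator of [y = x]: it equals [psi 0 = 1]
    there and decays elsewhere. The constant [K] dominates and is integrable for a probability
    measure. *)
Lemma cvg_convol_dil (R : realType) (psi : R -> R) (K delta : R)
    (mu : probability (measurableTypeR R) R) (x : R) :
  continuous psi -> psi 0 = 1 -> 0 <= K -> 0 < delta ->
  (forall x, `|psi x| <= K * (1 + `|x|) `^ (- delta)) ->
  convol (dil psi a) mu x @[a --> 0^'+] --> fine (mu [set x]).
Proof.
move=> cpsi psi0 K0 d0 psiK.
have -> : fine (mu [set x]) = Rintegral mu setT (\1_[set x] : measurableTypeR R -> R).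
  by rewrite /Rintegral integral_indic ?setIT.
apply: (@Rintegral_dominated_at_right _ _ _ _ _
  (fun (a : R) (y : measurableTypeR R) => psi ((x - y) / a)) _ (cst K)) => //.
- move=> a a0; apply: measurableT_comp; first exact: continuous_measurable_fun.
  by apply: measurable_funM => //; exact: measurable_funB.
- exact: finite_measure_integrable_cst.
- move=> a y a0 _; apply: (le_trans (psiK _)).
  by rewrite ler_piMr// powR_add1_norm_le1// ltW.
- move=> y _; rewrite indicE; have [->|yx] := eqVneq y x.
    rewrite mem_set//=; under eq_fun do rewrite subrr mul0r psi0.
    exact: cvg_cst.
  rewrite memNset/=; last exact/eqP.
  apply/norm_cvg0P; apply: (@squeeze_cvgr _ _ _ _ (cst 0)
    (fun a => K * (1 + `|x - y| / a) `^ (- delta))); first last.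
  + rewrite -[X in _ --> X](mulr0 K); apply: cvgM; first exact: cvg_cst.
    apply: (@cvg_comp _ _ _ (fun a => `|x - y| / a) (fun t => (1 + t) `^ (- delta))
      _ (pinfty_nbhs R)); last exact: cvgy_powR_add1.
    have xy0 : 0 < `|x - y| by rewrite normr_gt0 subr_eq0 eq_sym.
    (* For [A > 0] it suffices that [a < |x - y| / A]; for [A <= 0] positivity of the quotient is
       enough. *)
    apply/cvgryPgt => A; have [A0|A0] := leP A 0.
      by near=> a; rewrite (le_lt_trans A0)// divr_gt0.
    near=> a; rewrite ltr_pdivlMr// mulrC -ltr_pdivlMr//.
    by near: a; apply: nbhs_right_lt; rewrite divr_gt0.
  + exact: cvg_cst.
  + near=> a; rewrite normr_ge0/= (le_trans (psiK _))// normrM.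
    by rewrite (@ger0_norm _ a^-1) ?invr_ge0.
Unshelve. all: by end_near. Qed.

(** * Weak convergence of the smoothed measures *)

(** Fubini and [x = y + a * u] turn the left side into the integral of [psi u * f (y + a * u)] over
    [mu] times Lebesgue measure. The factor [a^-1] cancels the Jacobian, and a majorant depending on
    [u] alone works for every [a]. *)
Lemma cvg_Rintegral_convol_ndil (R : realType) (psi f : R -> R) (K M delta : R)
    (mu : probability (measurableTypeR R) R) :
  continuous psi -> 0 <= K -> 1 < delta ->
  (forall x, `|psi x| <= K * (1 + `|x|) `^ (- delta)) ->
  continuous f -> (forall x, `|f x| <= M) ->
  Rintegral (@lebesgue_measure R) setT (fun x => convol (ndil psi a) mu x * f x)
    @[a --> 0^'+]
  --> Rintegral (@lebesgue_measure R) setT psi * Rintegral mu setT f.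
Proof.
move=> cpsi K0 d1 psiK cf fM.
have M0 : 0 <= M by exact: le_trans (fM 0).
have mpsi : measurable_fun setT psi by exact: continuous_measurable_fun.
have mf : measurable_fun setT f by exact: continuous_measurable_fun.
pose L : {sigma_finite_measure set (measurableTypeR R) -> \bar R} := @lebesgue_measure R.
pose h (u : R) : R := K * M * (1 + `|u|) `^ (- delta).
have mh : measurable_fun setT h.
  apply: measurable_funM => //; apply: continuous_measurable_fun.
  exact: continuous_powR_add1_norm.
have hint : L.-integrable setT (EFin \o h).
  have := integrableZl measurableT (K * M) (integrable_powR_add1_norm R delta d1).
  by apply: eq_integrable => // u _ /=; rewrite EFinM.
have hM z x : `|psi z * f x| <= h z.
  rewrite normrM /h mulrAC; apply: ler_pM => //.
(* [P] is the integrand after the substitution; it makes sense at [a = 0], where it is the limit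
   integrand. *)
pose P (a : R) (z : measurableTypeR R * measurableTypeR R) : R :=
  psi z.2 * f (z.1 + a * z.2).
have mP a : measurable_fun setT (P a).
  apply: measurable_funM; first exact: measurableT_comp.
  apply: measurableT_comp => //; apply: measurable_funD => //.
  exact: measurable_funM.
have h2int : (mu \x L)%E.-integrable setT
    (EFin \o (fun z : measurableTypeR R * measurableTypeR R => h z.2)).
  apply/integrable12ltyP.
    by apply/measurable_EFinP; apply: measurableT_comp.
  move/integrableP : hint => [_] hoo.
  set c := (X in (X < +oo)%E) in hoo.
  suff : (\int[mu]_y cst c y < +oo)%E by [].
  by rewrite integral_cst// [X in (_ * X)%E]probability_setT mule1.
have Pint a : (mu \x L)%E.-integrable setT (EFin \o P a).
  apply: le_integrable h2int => //; first exact/measurable_EFinP.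
  by move=> z _; rewrite lee_fin/= (le_trans (hM _ _))// ler_norm.
have PE a : 0 < a ->
    Rintegral L setT (fun x => convol (ndil psi a) mu x * f x) =
    Rintegral (mu \x L)%E setT (P a).
  move=> a0.
  pose G (z : measurableTypeR R * measurableTypeR R) : R :=
    a^-1 * psi ((z.2 - z.1) / a) * f z.2.
  have mG : measurable_fun setT G.
    apply: measurable_funM; last exact: measurableT_comp.
    apply: measurable_funM => //; apply: measurableT_comp => //.
    by apply: measurable_funM => //; exact: measurable_funB.
  have GP y u : a * G (y, y + a * u) = P a (y, u).
    have a_neq0 : a != 0 by rewrite gt_eqF.
    rewrite /G/P/= (_ : (y + a * u - y) / a = u); last by field.
    by rewrite !mulrA mulfV// mul1r.
  (* Substituting in the inner integral of [|G|] gives that of [|P a|], so integrability carries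
     over and Fubini applies to [G]. *)
  have Gint : (mu \x L)%E.-integrable setT (EFin \o G).
    apply/integrable12ltyP; first exact/measurable_EFinP.
    under eq_integral => y _.
      rewrite (integral_affine _ a y) => //; last first.
        apply: measurableT_comp => //; apply/measurable_EFinP.
        exact: measurable_fun_pair2.
      under eq_integral => u _.
        rewrite -[a%:E]gee0_abs ?lee_fin ?ltW// -abseM -EFinM GP.
        over.
      over.
    by move/integrable12ltyP : (Pint a); apply; exact/measurable_EFinP.
  rewrite /Rintegral -(integral12_prod_meas1 (Pint a)); congr fine.
  transitivity (\int[L]_x \int[mu]_y (EFin \o G) (y, x))%E.
    apply: eq_integral => x _.
    have psixint : mu.-integrable setT
        (EFin \o (fun y : measurableTypeR R => ndil psi a (x - y))).
      apply: (@le_integrable _ _ _ mu setT _ _ (cst (a^-1 * K)%:E)) => //.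
      + apply/measurable_EFinP; rewrite /ndil /dil.
        apply: measurable_funM => //; apply: measurableT_comp => //.
        by apply: measurable_funM => //; exact: measurable_funB.
      + move=> y _; have a1 : 0 <= a^-1 by rewrite invr_ge0 ltW.
        rewrite lee_fin/= /ndil /dil normrM (ger0_norm a1).
        rewrite (@ger0_norm _ (a^-1 * K)) ?mulr_ge0// ler_wpM2l//.
        rewrite (le_trans (psiK _))//.
        by rewrite ler_piMr// powR_add1_norm_le1// (le_trans _ (ltW d1)).
      + exact: finite_measure_integrable_cst.
    rewrite /convol -RintegralZr// /Rintegral fineK//.
    apply: integrable_fin_num => //.
    have := integrableZr measurableT (f x) psixint.
    by apply: eq_integrable.
  rewrite -(Fubini Gint); apply: eq_integral => y _.
  rewrite (integral_affine _ a y) => //; last first.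
    by apply/measurable_EFinP; exact: measurable_fun_pair2.
  by apply: eq_integral => u _; rewrite /= -EFinM GP.
have lim0 : Rintegral (mu \x L)%E setT (P a) @[a --> 0^'+] -->
    Rintegral (mu \x L)%E setT (P 0).
  apply: (@Rintegral_dominated_at_right _ _ _ _ _ P (P 0) (fun z => h z.2)) => //.
  - by move=> a z _ _; exact: hM.
  - move=> z _; apply: cvgM; first exact: cvg_cst.
    apply: cvg_at_right_filter.
    apply: (@cvg_comp _ _ _ (fun a => z.1 + a * z.2) f); last exact: cf.
    apply: cvgD; first exact: cvg_cst.
    by apply: cvgM; [exact: cvg_id|exact: cvg_cst].
(* At [a = 0] the integrand is [psi u * f y], and the double integral factors. *)
have -> : Rintegral L setT psi * Rintegral mu setT f = Rintegral (mu \x L)%E setT (P 0).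
  have psiint : L.-integrable setT (EFin \o psi).
    have := integrableZl measurableT K (integrable_powR_add1_norm R delta d1).
    apply: le_integrable => //; first exact/measurable_EFinP.
    by move=> u _; rewrite -EFinM lee_fin/= (le_trans (psiK _))// ler_norm.
  have fint : mu.-integrable setT (EFin \o f).
    apply: (@le_integrable _ _ _ mu setT _ _ (cst M%:E)) => //.
    + exact/measurable_EFinP.
    + by move=> y _; rewrite lee_fin/= [leRHS]ger0_norm.
    + exact: finite_measure_integrable_cst.
  rewrite -RintegralZl// /Rintegral -(integral12_prod_meas1 (Pint 0)); congr fine.
  apply: eq_integral => y _; rewrite /P/=.
  under [RHS]eq_integral do rewrite /= mul0r addr0 EFinM.
  rewrite integralZr// EFinM; congr (_ * _)%E.
  by rewrite fineK//; exact: integrable_fin_num.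
apply: cvg_trans lim0; apply: near_eq_cvg; near=> a.
by rewrite PE.
Unshelve. all: by end_near. Qed.

(** * Fractional densities: the limit at scale [a ^ alpha] *)

(** Near 0 the ratio is within 1 of [L]; from [e0] on, the mass is at most 1 and the denominator at
    least [(2 * e0) ^ alpha]. A bound at all scales is required because the ratio is evaluated at
    [a * s] with [s] unbounded. *)
Lemma dratio_bounded (R : realType)
    (mu : probability (measurableTypeR R) R) (alpha x L : R) :
  0 < alpha -> dalpha_is mu alpha x L ->
  exists B : R, forall e, 0 < e -> `|dratio mu alpha x e| <= B.
Proof.
move=> a0 /cvgrPdist_lt/(_ 1 ltr01) [e0 /= e00 near0].
exists (`|L| + 1 + ((2 * e0) `^ alpha)^-1) => e e_gt0.
have p0 : 0 <= ((2 * e0) `^ alpha)^-1 by rewrite invr_ge0 powR_ge0.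
have [ee0|ee0] := ltP e e0.
  have := near0 e; rewrite /= sub0r normrN (ger0_norm (ltW e_gt0)) => /(_ ee0 e_gt0) Le.
  have := ler_normB L (L - dratio mu alpha x e).
  by rewrite subKr; lra.
have L0 : 0 <= `|L| + 1 by rewrite addr_ge0.
apply: (@le_trans _ _ ((2 * e0) `^ alpha)^-1); last by rewrite lerDr.
rewrite /dratio set_mem_set normrM normfV (ger0_norm (powR_ge0 _ _)).
rewrite -[leRHS]mul1r; apply: ler_pM; rewrite ?invr_ge0 ?powR_ge0//.
  rewrite ger0_norm ?fine_ge0// -lee_fin fineK ?fin_num_measure//.
  exact: probability_le1.
rewrite lef_pV2 ?posrE ?powR_gt0 ?mulr_gt0//.
by apply: ge0_ler_powR; rewrite ?nnegrE; lra.
Qed.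

(** Here [k] plays the role of [- psi']. The layer-cake formula is used for [mu], with
    [g t = |x - t| / a], and for Lebesgue measure with a power weight; dominated convergence links
    the two resulting integrals. *)
Lemma cvg_powR_convol_dil (R : realType) (psi k : R -> R) (K delta : R)
    (mu : probability (measurableTypeR R) R) (alpha x L : R) :
  (forall u, psi (- u) = psi u) -> continuous k -> 0 <= K -> 1 < delta ->
  (forall beta s, 0 <= beta -> beta <= 1 -> 0 <= s ->
    s `^ beta * `|k s| <= K * (1 + s) `^ (- delta)) ->
  (forall u, 0 <= u -> Rintegral (@lebesgue_measure R) `[u, +oo[ k = psi u) ->
  0 < alpha -> alpha <= 1 -> dalpha_is mu alpha x L ->
  a `^ (- alpha) * convol (dil psi a) mu x @[a --> 0^'+]
  --> Rintegral (@lebesgue_measure R) `]0, +oo[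
        (fun y => alpha * 2 `^ alpha * y `^ (alpha - 1) * psi y) * L.
Proof.
move=> psi_even ck K0 d1 kK psiE a0 a1 muL.
have mk : measurable_fun setT k by exact: continuous_measurable_fun.
have [B dB] := dratio_bounded R mu alpha x L a0 muL.
have psi_norm u : psi `|u| = psi u.
  by have [_|_] := ger0P u; rewrite ?psi_even.
pose leb : {sigma_finite_measure set (measurableTypeR R) -> \bar R} :=
  @lebesgue_measure R.
pose D : set (measurableTypeR R) := `]0, +oo[%classic.
have mD : measurable D by exact: measurable_itv.
(* Each integrability claim about [k] below follows from the hypothesis on [s ^ beta * |k s|], with
   [beta] equal to 0 or [alpha]. *)
have dom (E : set (measurableTypeR R)) (g : R -> R) (c beta : R) :
    measurable E -> E `<=` [set s | 0 <= s] -> measurable_fun E g ->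
    0 <= beta -> beta <= 1 ->
    (forall s, E s -> `|g s| <= c * (s `^ beta * `|k s|)) ->
    leb.-integrable E (EFin \o g).
  move=> mE E0 mg b0 b1 gk.
  have := integrableZl measurableT (`|c| * K) (integrable_powR_add1_norm R delta d1).
  move=> /(@integrableS _ _ _ _ _ E)-/(_ measurableT mE (@subsetT _ _)).
  apply: le_integrable => //; first exact/measurable_EFinP.
  move=> s Es; rewrite -EFinM lee_fin/=; apply: (le_trans (gk _ Es)).
  have s0 : 0 <= s := E0 _ Es.
  have p0 : 0 <= s `^ beta * `|k s| by rewrite mulr_ge0 ?powR_ge0.
  rewrite (ger0_norm s0) normrM (ger0_norm (powR_ge0 _ _)) normrM normr_id.
  rewrite (ger0_norm K0) -mulrA.
  apply: (@le_trans _ _ (`|c| * (s `^ beta * `|k s|))).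
    by rewrite ler_wpM2r// ler_norm.
  by rewrite ler_wpM2l// kK.
have D0 : D `<=` [set s | 0 <= s].
  by move=> s; rewrite /D/= in_itv/= andbT => /ltW.
have Dgt0 s : D s -> 0 < s by rewrite /D/= in_itv/= andbT.
have kint : leb.-integrable `[0, +oo[ (EFin \o k).
  apply: (dom _ _ 1 0) => //; first by move=> s; rewrite /= in_itv/= andbT.
    exact: measurable_funTS.
  by move=> s _; rewrite powRr0 !mul1r.
pose N e := fine (mu [set t | `|x - t| < e]).
have setE e : [set t | `|x - t| < e] = `]x - e, x + e[%classic.
  by apply/seteqP; split => t; rewrite /= in_itv/= distrC ltr_distl.
have mball e : measurable ([set t | `|x - t| < e] : set (measurableTypeR R)).
  by rewrite setE.
have N0 e : 0 <= N e by rewrite fine_ge0.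
have N1 e : N e <= 1.
  by rewrite -lee_fin fineK ?fin_num_measure//; exact: probability_le1.
have mN : measurable_fun setT N.
  apply: nondecreasing_measurable => // e1 e2 e12.
  rewrite -lee_fin !fineK ?fin_num_measure//.
  by apply: le_measure; rewrite ?inE// => t /= /lt_le_trans; apply.
have NdE e : 0 < e -> N e = dratio mu alpha x e * (2 * e) `^ alpha.
  move=> e0; rewrite /dratio mulfVK ?gt_eqF ?powR_gt0 ?mulr_gt0//.
  by rewrite set_mem_set /N setE.
have mpow : measurable_fun setT (fun s : R => (2 * s) `^ alpha).
  apply: (@measurableT_comp _ _ _ _ _ _ (fun t : R => t `^ alpha)).
    exact: measurable_powR.
  exact: measurable_funM.
have mNa a : measurable_fun setT (fun s : R => N (a * s)).
  by apply: measurableT_comp => //; exact: measurable_funM.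
have convolE a : 0 < a ->
    convol (dil psi a) mu x = Rintegral leb D (fun s => k s * N (a * s)).
  move=> a_gt0.
  rewrite -(@Rintegral_layer_cake _ mu (fun t => `|x - t| / a) (cst 1)
    (fun s => N (a * s)) k psi) //.
  - rewrite /convol /dil; apply: eq_Rintegral => t _.
    by rewrite mulr1 -psi_norm normrM (@ger0_norm _ a^-1) ?invr_ge0 ?ltW.
  - by apply: measurable_funM => //; apply: measurableT_comp => //; exact: measurable_funB.
  - by move=> t; rewrite divr_ge0// ltW.
  - move=> s s0.
    rewrite (_ : [set t | `|x - t| / a < s] = [set t | `|x - t| < a * s]); last first.
      by apply/seteqP; split => t /=; rewrite ltr_pdivrMr// mulrC.
    transitivity (\int[mu]_(t in [set t | (`|x - t| < a * s)%R]) cst 1 t)%E => //.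
    by rewrite integral_cst// mul1e fineK// fin_num_measure.
  - apply: (dom _ _ 1 0) => //.
      exact: measurable_funTS (measurable_funM mk (mNa a)).
    by move=> s _; rewrite powRr0 !mul1r normrM ler_piMr// ger0_norm.
have scaledE a : 0 < a -> a `^ (- alpha) * convol (dil psi a) mu x =
    Rintegral leb D (fun s => k s * (2 * s) `^ alpha * dratio mu alpha x (a * s)).
  move=> a_gt0; rewrite convolE// -RintegralZl//; last first.
    apply: (dom _ _ 1 0) => //.
      exact: measurable_funTS (measurable_funM mk (mNa a)).
    by move=> s _; rewrite powRr0 !mul1r normrM ler_piMr// ger0_norm.
  (* Since [(2 * (a * s)) ^ alpha] splits off [a ^ alpha], the prefactor cancels. *)
  apply: eq_Rintegral => s; rewrite inE => /Dgt0 s0.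
  rewrite NdE ?mulr_gt0// (mulrCA 2 a s).
  rewrite [in LHS]powRM ?(ltW a_gt0) ?mulr_ge0 ?(ltW s0)// powRN.
  by field; rewrite gt_eqF ?powR_gt0.
have weightE : Rintegral leb D (fun y => alpha * 2 `^ alpha * y `^ (alpha - 1) * psi y)
    = Rintegral leb D (fun s => k s * (2 * s) `^ alpha).
  (* The weight vanishes for [t <= 0], so its integral over [|t| < s] is the one over []0, s[],
     namely [(2 * s) ^ alpha]. *)
  pose w t : R := if 0 < t then alpha * 2 `^ alpha * t `^ (alpha - 1) else 0.
  rewrite -(@Rintegral_layer_cake _ leb Num.norm w
    (fun s => (2 * s) `^ alpha) k psi) //.
  - rewrite Rintegral_mkcond; apply: eq_Rintegral => t _.
    rewrite /patch /w psi_norm; case: ifPn => [|/negP]; rewrite inE.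
      by move=> /Dgt0 ->; rewrite mulrC.
    by rewrite /D/= in_itv/= andbT => /negP/negbTE ->; rewrite mulr0.
  - apply: measurable_fun_ifT => //.
      exact: measurable_fun_ltr.
    by apply: measurable_funM => //; exact: measurable_powR.
  - move=> t; rewrite /w; case: ifP => // _.
    by rewrite !mulr_ge0 ?powR_ge0 ?ltW.
  - move=> s s0.
    transitivity (\int[leb]_(t in `]0%R, s[)
        ((2 `^ alpha)%:E * (alpha * t `^ (alpha - 1))%:E))%E.
      rewrite integral_mkcond [RHS]integral_mkcond; apply: eq_integral => t _.
      rewrite /patch /w; case: ifPn => [|/negP]; rewrite inE/= => ts.
        case: ifPn => t0.
          rewrite mem_set/=; first by rewrite -EFinM; congr EFin; ring.
          by rewrite in_itv/= t0 -(gtr0_norm t0).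
        by rewrite memNset//= in_itv/= (negbTE t0).
      rewrite memNset//= in_itv/= => /andP[t0 st]; apply: ts.
      by rewrite gtr0_norm.
    rewrite ge0_integralZl//=.
    + by rewrite integral_powR_subr1// -EFinM -powRM// ltW.
    + apply/measurable_EFinP; apply: measurable_funTS.
      by apply: measurable_funM => //; exact: measurable_powR.
    + by move=> t _; rewrite lee_fin mulr_ge0 ?powR_ge0 ?ltW.
  - apply: (dom _ _ (2 `^ alpha) alpha) => //.
    + exact: measurable_funTS (measurable_funM mk mpow).
    + exact: ltW.
    + move=> s /D0 s0; rewrite normrM (ger0_norm (powR_ge0 _ _)) powRM//.
      by rewrite mulrC mulrA.
rewrite weightE -RintegralZr//; last first.
  apply: (dom _ _ (2 `^ alpha) alpha) => //.
  + exact: measurable_funTS (measurable_funM mk mpow).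
  + exact: ltW.
  + move=> s /D0 s0; rewrite normrM (ger0_norm (powR_ge0 _ _)) powRM//.
    by rewrite mulrC mulrA.
have B0 : 0 <= B by exact: le_trans (dB 1 ltr01).
have mdr a : 0 < a -> measurable_fun D (fun s => dratio mu alpha x (a * s)).
  move=> a_gt0; apply: (@eq_measurable_fun _ _ _ _ D
    (fun s => N (a * s) * (2 * (a * s)) `^ (- alpha))).
    move=> s; rewrite inE => /Dgt0 s0.
    by rewrite NdE ?mulr_gt0// powRN mulfK// gt_eqF// powR_gt0// !mulr_gt0.
  apply: measurable_funTS; apply: measurable_funM; first exact: mNa.
  apply: (@measurableT_comp _ _ _ _ _ _ (fun t : R => t `^ (- alpha))).
    exact: measurable_powR.
  by apply: measurable_funM => //; exact: measurable_funM.
apply: (@cvg_trans _ (Rintegral leb D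
    (fun s => k s * (2 * s) `^ alpha * dratio mu alpha x (a * s)) @[a --> 0^'+])).
  by apply: near_eq_cvg; near=> a; rewrite scaledE.
(* The majorant combines the bound [B] on the ratio with [(2 * s) ^ alpha * |k s|]. *)
apply: (@Rintegral_dominated_at_right _ (measurableTypeR R) _ leb D
  (fun a s => k s * (2 * s) `^ alpha * dratio mu alpha x (a * s))
  (fun s => k s * (2 * s) `^ alpha * L)
  (fun s => B * 2 `^ alpha * (s `^ alpha * `|k s|))) => //.
- move=> a a_gt0; apply: measurable_funM; last exact: mdr.
  exact: measurable_funTS (measurable_funM mk mpow).
- apply: measurable_funM => //.
  exact: measurable_funTS (measurable_funM mk mpow).
- apply: (dom _ _ (B * 2 `^ alpha) alpha) => //.
  + apply: measurable_funTS; apply: measurable_funM => //.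
    apply: measurable_funM; first exact: measurable_powR.
    exact: measurableT_comp.
  + exact: ltW.
  + by move=> s _; rewrite ger0_norm// !mulr_ge0 ?powR_ge0.
- move=> a s a_gt0 Ds; have s0 := Dgt0 _ Ds.
  rewrite normrM (normrM (k s)) (ger0_norm (powR_ge0 _ _)) powRM ?(ltW s0)//.
  rewrite (_ : B * _ * _ = `|k s| * (2 `^ alpha * s `^ alpha) * B); last by ring.
  apply: ler_wpM2l; last exact/dB/mulr_gt0.
  by rewrite !mulr_ge0 ?powR_ge0.
- move=> s /Dgt0 s0; apply: cvgM; first exact: cvg_cst.
  (* For fixed [s > 0], [a * s] decreases to 0 with [a], so the ratio tends to [L]. *)
  apply/cvg_at_rightP => u [u0 ucvg].
  have /cvg_at_rightP := muL; apply; split; first by move=> n; rewrite mulr_gt0.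
  by rewrite -[X in _ --> X](mul0r s); apply: cvgM => //; exact: cvg_cst.
Unshelve. all: by end_near. Qed.

(** * The three limits from the decay of [psi] and its derivative *)

Theorem theorem2p2 (R : realType) (psi : R -> R)
  (psi_diff : forall x, derivable psi x 1)
  (psi_C1 : continuous (derive1 psi))
  (psi0 : psi 0 = 1)
  (psi_even : forall x, psi (- x) = psi x)
  (psi_decay : exists C delta : R, 0 < C /\ 1 < delta /\
     forall x, `|psi x| + `|x * (derive1 psi) x| <= C * jbr x `^ (- delta))
  (psi_int_neq0 : Rintegral (@lebesgue_measure R) setT psi != 0)
  (mu : probability (measurableTypeR R) R) :
  (forall f : R -> R, continuous f ->
     (exists K : set R, compact K /\ forall x, ~ K x -> f x = 0) ->
     Rintegral (@lebesgue_measure R) setT (fun x => convol (ndil psi a) mu x * f x)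
       @[a --> 0^'+]
     --> Rintegral (@lebesgue_measure R) setT psi * Rintegral mu setT f)
  /\ (forall x : R, convol (dil psi a) mu x @[a --> 0^'+] --> fine (mu [set x]))
  /\ (forall alpha x L : R, 0 < alpha -> alpha <= 1 -> dalpha_is mu alpha x L ->
       a `^ (- alpha) * convol (dil psi a) mu x @[a --> 0^'+]
       --> Rintegral (@lebesgue_measure R) `]0, +oo[
             (fun y => alpha * 2 `^ alpha * y `^ (alpha - 1) * psi y) * L).
Proof.
have [C [delta [C0 [d1 decay]]]] := psi_decay.
have d0 : 0 < delta by exact: lt_trans d1.
have cpsi : continuous psi.
  by move=> x; apply: differentiable_continuous; apply/derivable1_diffP.
have psiK x : `|psi x| <= C * 2 `^ delta * (1 + `|x|) `^ (- delta).
  apply: le_trans (_ : C * jbr x `^ (- delta) <= _).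
    by apply: le_trans (decay x); rewrite lerDl.
  by rewrite -mulrA ler_wpM2l ?(ltW C0)// jbr_powR_le// ltW.
have CK0 : 0 <= C * 2 `^ delta by rewrite mulr_ge0 ?powR_ge0// ltW.
split.
  move=> f cf [K [cK fK]].
  (* The image of the compact set [K] under [f] is bounded, and [f] vanishes off [K]. *)
  have [M fM] : exists M, forall x, `|f x| <= M.
    have /compact_bounded/pinfty_ex_gt0[M M0 fM] : compact (f @` K).
      by apply: continuous_compact => //; exact: continuous_subspaceT.
    exists M => x; have [Kx|/fK ->] := pselect (K x); last by rewrite normr0 ltW.
    by apply: fM; exists x.
  exact: (cvg_Rintegral_convol_ndil R psi f _ M delta mu cpsi CK0 d1 psiK cf fM).
split; first by move=> x; exact: (cvg_convol_dil R psi _ delta mu x cpsi psi0 CK0 d0 psiK).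
pose k x := - derive1 psi x.
have ck : continuous k by move=> x; apply: cvgN; exact: psi_C1.
have [K K0 kK] : exists2 K : R, 0 <= K & forall beta s, 0 <= beta -> beta <= 1 ->
    0 <= s -> s `^ beta * `|k s| <= K * (1 + s) `^ (- delta).
  apply: (powR_mul_norm_le R k C delta ck C0 d0) => x.
  by apply: le_trans (decay x); rewrite /k mulrN normrN lerDr.
move=> alpha x L a0 a1 muL.
apply: (cvg_powR_convol_dil R psi k K delta) => //.
move=> u u0; rewrite -[RHS]opprK.
(* The primitive of [k] is [- psi], which vanishes at infinity. The majorant uses [|t|] to be
   continuous on the whole line; for [t >= u >= 0] it is the derivative of the given power of
   [1 + t]. *)
apply: (@Rintegral_FTC2y_dominated R (fun t => - psi t) k
  (fun t => K * ((1 - delta)^-1 * (1 + t) `^ (1 - delta)))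
  (fun t => K * (1 + `|t|) `^ (- delta))) => //.
- by move=> t; apply: cvgM; [exact: cvg_cst|exact: continuous_powR_add1_norm].
- move=> t _; apply: is_deriveN; rewrite derive1E; exact/derivableP.
- move=> t ut; have t0 := le_trans u0 ut.
  have dp := is_derive_powR_add1 R (1 - delta) t t0.
  have := is_deriveZ K (is_deriveZ (1 - delta)^-1 dp).
  rewrite /GRing.scale/= (ger0_norm t0) mulKf; last by lra.
  by rewrite addrAC subrr add0r; exact.
- move=> t ut; have t0 := le_trans u0 ut.
  (* The case [beta = 0] of the weighted bound. *)
  by have := kK 0 t (lexx _) ler01 t0; rewrite powRr0 mul1r (ger0_norm t0).
- rewrite -oppr0; apply: cvgN; apply/norm_cvg0P.
  apply: (@squeeze_cvgr _ _ _ _ (cst 0)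
    (fun t => C * 2 `^ delta * (1 + t) `^ (- delta))).
  + near=> t; have t0 : 0 <= t by near: t; exact: nbhs_pinfty_ge.
    by rewrite normr_ge0/=; have := psiK t; rewrite (ger0_norm t0).
  + exact: cvg_cst.
  + rewrite -[X in _ --> X](mulr0 (C * 2 `^ delta)).
    by apply: cvgM; [exact: cvg_cst|exact: cvgy_powR_add1].
- rewrite -[X in _ --> X](mulr0 K); apply: cvgM; first exact: cvg_cst.
  rewrite -[X in _ --> X](mulr0 (1 - delta)^-1); apply: cvgM; first exact: cvg_cst.
  have := cvgy_powR_add1 R (delta - 1).
  by rewrite opprB subr_gt0; apply.
Unshelve. all: by end_near. Qed.
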